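(* For $\lambda\in\overline{K}_c$ with $|\lambda|<1$ let $$u(t,\lambda)=\sum_{n=0}^\infty\left\{\prod_{j=0}^{n-1}(\lambda-[j])\right\}f_n(t),\qquad t\in O,$$ that is, $u(\cdot,\lambda)$ is the solution, with coefficient $c_0=1$ in its expansion $\sum_{i\ge 0} c_if_i(t)$, of the equation $u(xt)-xu(t)=\lambda u(t)$, $t\in O$. Then: (i) The function $t\mapsto u(t,\lambda)$ is continuous on $O$. (ii) The function $t\mapsto u(t,\lambda)$ is analytic on $O$ if and only if $\lambda=[j]$ for some integer $j\ge 0$; in this case $u(t,\lambda)=u(t,[j])=t^{q^j}$. (iii) If $\lambda\ne[j]$ for every integer $j\ge 0$, then $t\mapsto u(t,\lambda)$ is locally analytic on $O$ if and only if $\lambda=-x$, and in that case $u(t,-x)=0$ for all $t\in O$ with $|t|\le q^{-1}$. (iv) The relation $$u(t^{q^m},\lambda)=u(t,\lambda^{q^m}+[m]),\qquad t\in O,$$ holds for all $\lambda\in\overline{K}_c$ with $|\lambda|<1$ and all $m=0,1,2,\ldots$.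
   Context: Let $q$ be a power of a prime $p$, and let $K=\mathbf F_q((x))$ be the field of formal Laurent series $t=\sum_{j\ge N}\xi_jx^j$, $\xi_j\in\mathbf F_q$, with absolute value $|t|=q^{-N}$ if $\xi_N\neq 0$, $|0|=0$. Let $O=\{t\in K:|t|\le 1\}=\mathbf F_q[[x]]$. Let $\overline{K}_c$ be the completion of an algebraic closure of $K$, with the uniquely extended absolute value. For an integer $j\ge 0$ put $[j]=x^{q^j}-x$ (so $[0]=0$). Carlitz polynomials: $f_i(t)=D_i^{-1}e_i(t)$, where $D_0=1$, $D_i=[i][i-1]^q\cdots[1]^{q^{i-1}}$, $e_0(t)=t$, and $e_i(t)=\prod_{\omega\in\mathbf F_q[x],\,\deg\omega<i}(t-\omega)$ for $i\ge 1$ (the product includes $\omega=0$). Every continuous $\mathbf F_q$-linear function $u:O\to\overline{K}_c$ has a unique expansion $u=\sum_{i\ge 0}c_if_i$ with $c_i\in\overline{K}_c$, $c_i\to 0$, and conversely each such series converges uniformly on $O$ to a continuous $\mathbf F_q$-linear function. An empty product equals $1$. A function $O\to\overline{K}_c$ is analytic on a ball if on that ball it equals the sum of a power series with coefficients in $\overline{K}_c$ (centered at a point of the ball) convergent on the whole ball ($O$ itself being a ball); it is locally analytic on $O$ if each point of $O$ has a ball neighbourhood in $O$ on which the function is analytic. *)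

(* Defs.v *)
From HB Require Import structures.
From mathcomp Require Import all_boot all_order all_algebra.
From mathcomp Require Import zify.
From mathcomp Require Import all_classical all_reals topology sequences.

Set Implicit Arguments.
Unset Strict Implicit.
Unset Printing Implicit Defensive.

Import Order.TTheory GRing.Theory Num.Theory.
Local Open Scope classical_set_scope.
Local Open Scope ring_scope.

Section LaurentDef.
Variable F : fieldType.

Definition lbounded (f : int -> F) (N : int) := forall j, j < N -> f j = 0.

Definition laurent_pred : {pred int -> F} := fun f => `[< exists N, lbounded f N >].

(* Elements are the formal series \sum_j f_j x^j, given by f : int -> F with
   f_j = 0 for all j below some N. *)
Record laurent := Laurent { coefl :> int -> F; _ : laurent_pred coefl }.
HB.instance Definition _ := [isSub for coefl].
HB.instance Definition _ := [Choice of laurent by <:].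

Lemma laurentP (f : laurent) : exists N, lbounded f N.
Proof. by case: f => f /= /asboolP. Qed.

Lemma laurent_ext (f g : laurent) : (forall n, f n = g n) -> f = g.
Proof. by move=> h; apply/val_inj/funext. Qed.

Lemma lbounded_le f M N : M <= N -> lbounded f N -> lbounded f M.
Proof. by move=> MN b j jM; apply: b; apply: lt_le_trans MN. Qed.

Lemma lbounded2 f g N M : lbounded f N -> lbounded g M ->
  exists K, lbounded f K /\ lbounded g K.
Proof.
move=> fN gM.
by exists (Num.min N M); split; [apply: lbounded_le fN | apply: lbounded_le gM];
  rewrite ge_min lexx ?orbT.
Qed.

Fact laurent_zmod_closed : zmod_closed laurent_pred.
Proof.
split=> [|f g /asboolP[N fN] /asboolP[M gM]].
  by apply/asboolP; exists 0 => j _.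
have [K [fK gK]] := lbounded2 fN gM.
by apply/asboolP; exists K => j jK; rewrite !fctE fK // gK // subr0.
Qed.
HB.instance Definition _ :=
  GRing.isZmodClosed.Build (int -> F) laurent_pred laurent_zmod_closed.
HB.instance Definition _ := [SubChoice_isSubZmodule of laurent by <:].

(* The sum over all of int has finitely many nonzero terms when f and g are
   bounded below; lmul below is this Cauchy product on Laurent series. *)
Definition conv (f g : int -> F) : int -> F :=
  fun n => \sum_(i \in [set: int]) f i * g (n - i).

Definition pconv (a b : nat -> F) : nat -> F :=
  fun n => \sum_(i < n.+1) a i * b (n - i)%N.

Definition lshift (N : int) (f : int -> F) : nat -> F := fun k => f (N + k%:Z).

Lemma lbounded_conv f g N M :
  lbounded f N -> lbounded g M -> lbounded (conv f g) (N + M).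
Proof.
move=> fN gM j jNM; rewrite /conv fsbig1// => i _.
have [iN|Ni] := ltP i N; first by rewrite fN ?mul0r.
by rewrite gM ?mulr0//; lia.
Qed.

Lemma lshift_conv f g N M : lbounded f N -> lbounded g M ->
  lshift (N + M) (conv f g) =1 pconv (lshift N f) (lshift M g).
Proof.
move=> fN gM k; rewrite /lshift /conv /pconv.
rewrite -(@fsbig_widen int F 0 +%R [set N + i%:Z | i in `I_k.+1]) //; last first.
  move=> i [_ /= h]; have [iN|Ni] := ltP i N; first by rewrite fN ?mul0r.
  have [ik|ki] := ltP (N + k%:Z) i; first by rewrite gM ?mulr0//; lia.
  by case: h; exists `|i - N|%N => /=; lia.
rewrite fsbig_image /=; last by move=> i j _ _ /=; lia.
rewrite -(@fsbig_ord F 0 +%R k.+1 (fun i => f (N + i%:Z) * g (N + M + k%:Z - (N + i%:Z)))).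
apply: eq_bigr => i _; congr (_ * g _).
by have := ltn_ord i; lia.
Qed.

Lemma laurent_shift (f g : int -> F) N : lbounded f N -> lbounded g N ->
  lshift N f =1 lshift N g -> forall n, f n = g n.
Proof.
move=> fN gN e n; have [nN|Nn] := ltP n N; first by rewrite fN ?gN.
by have := e `|n - N|%N; rewrite /lshift; have -> : N + `|n - N|%N%:Z = n by lia.
Qed.

Definition ptrunc n (a : nat -> F) : {poly F} := \poly_(i < n) a i.

Lemma pconv_poly n (a b : nat -> F) (p r : {poly F}) :
  (forall i, (i <= n)%N -> p`_i = a i) -> (forall i, (i <= n)%N -> r`_i = b i) ->
  forall k, (k <= n)%N -> (p * r)`_k = pconv a b k.
Proof.
move=> pa rb k kn; rewrite coefM; apply: eq_bigr => i _.
by rewrite pa ?rb//; have := ltn_ord i; lia.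
Qed.

Lemma coef_ptrunc n (a : nat -> F) i : (i <= n)%N -> (ptrunc n.+1 a)`_i = a i.
Proof. by move=> ni; rewrite coef_poly ltnS ni. Qed.

Lemma pconvC a b : pconv a b =1 pconv b a.
Proof.
move=> n; rewrite -(pconv_poly (@coef_ptrunc n a) (@coef_ptrunc n b) (leqnn n)).
by rewrite mulrC (pconv_poly (@coef_ptrunc n b) (@coef_ptrunc n a)).
Qed.

Lemma pconvA a b c : pconv a (pconv b c) =1 pconv (pconv a b) c.
Proof.
move=> n.
have Ta := @coef_ptrunc n a; have Tb := @coef_ptrunc n b.
have Tc := @coef_ptrunc n c.
rewrite -(pconv_poly Ta (pconv_poly Tb Tc) (leqnn n)) mulrA.
by rewrite (pconv_poly (pconv_poly Ta Tb) Tc).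
Qed.

Definition lmul (f g : laurent) : laurent.
Proof.
refine (@Laurent (conv f g) _).
abstract (have [N fN] := laurentP f; have [M gM] := laurentP g;
  by apply/asboolP; exists (N + M); exact: lbounded_conv).
Defined.

Definition lpoly (p : {poly F}) : laurent.
Proof.
refine (@Laurent (fun j => if j is Posz n then p`_n else 0) _).
abstract (by apply/asboolP; exists 0; case).
Defined.

Lemma lmulC : commutative lmul.
Proof.
move=> f g; apply: laurent_ext.
have [N fN] := laurentP f; have [M gM] := laurentP g.
apply: (@laurent_shift _ _ (N + M)) => [||k].
- exact: lbounded_conv.
- by rewrite addrC; exact: lbounded_conv.
- by rewrite lshift_conv// pconvC addrC lshift_conv.
Qed.

Lemma eq_pconv a a' b b' : a =1 a' -> b =1 b' -> pconv a b =1 pconv a' b'.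
Proof. by move=> aa bb n; apply: eq_bigr => i _; rewrite aa bb. Qed.

Lemma lmulA : associative lmul.
Proof.
move=> f g h; apply: laurent_ext.
have [N fN] := laurentP f; have [M gM] := laurentP g.
have [L hL] := laurentP h.
have fg := lbounded_conv fN gM; have gh := lbounded_conv gM hL.
apply: (@laurent_shift _ _ (N + (M + L))) => [||k].
- exact: lbounded_conv.
- by rewrite addrA; exact: lbounded_conv.
- rewrite lshift_conv//= (eq_pconv (frefl _) (lshift_conv gM hL)).
  by rewrite pconvA addrA lshift_conv//= (eq_pconv (lshift_conv fN gM) (frefl _)).
Qed.

Lemma lmul1 : left_id (lpoly 1) lmul.
Proof.
move=> f; apply: laurent_ext => n /=.
rewrite /conv -(@fsbig_widen int F 0 +%R [set 0])//; last first.
  by move=> [[|i]|i] [_ /= h]; rewrite ?coef1 ?mul0r//; case: h.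
by rewrite fsbig_set1 /= coef1 mul1r subr0.
Qed.

Lemma lmulDl : left_distributive lmul +%R.
Proof.
move=> f g h; apply: laurent_ext.
have [? fN] := laurentP f; have [? gN] := laurentP g.
have {fN gN}[N [fN gN]] := lbounded2 fN gN; have [M hM] := laurentP h.
have fgN : lbounded (f + g) N by move=> j jN /=; rewrite !fctE fN // gN // addr0.
apply: (@laurent_shift _ _ (N + M)) => [||k].
- exact: lbounded_conv.
- by move=> j jN /=; rewrite !fctE !(lbounded_conv _ hM jN)// addr0.
- rewrite lshift_conv//.
  transitivity (pconv (lshift N f) (lshift M h) k +
                pconv (lshift N g) (lshift M h) k).
    by rewrite -big_split; apply: eq_bigr => i _; exact: mulrDl.
  by rewrite -!lshift_conv.
Qed.

Lemma lone_neq0 : lpoly 1 != 0.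
Proof.
apply/eqP => /(congr1 (fun f : laurent => f 0)) /=.
by rewrite coef1 /= => /eqP; rewrite oner_eq0.
Qed.

HB.instance Definition _ := GRing.Zmodule_isComNzRing.Build laurent
  lmulA lmulC lmul1 lmulDl lone_neq0.

Lemma pconv_inv (a : nat -> F) : a 0%N != 0 ->
  exists b, pconv a b =1 fun n => (n == 0)%:R.
Proof.
move=> a0.
(* s n lists the first n coefficients of the inverse *)
pose nxt (s : seq F) : F := ((size s == 0%N)%:R -
  \sum_(i < size s) a i.+1 * s`_(size s - i.+1)) / a 0%N.
pose s n := iter n (fun s => rcons s (nxt s)) [::].
have size_s n : size (s n) = n by elim: n => //= n IH; rewrite size_rcons IH.
pose b n := (s n.+1)`_n.
have sE n i : (i < n)%N -> (s n)`_i = b i.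
  elim: n => // n IH; rewrite ltnS leq_eqVlt => /predU1P[->//|ltin].
  by rewrite /= nth_rcons size_s ltin IH.
exists b => n; rewrite /pconv big_ord_recl /= subn0.
have -> : b n = nxt (s n) by rewrite /b /= nth_rcons size_s ltnn eqxx.
rewrite /nxt size_s mulrC divfK//.
rewrite [X in _ - X](_ : _ =
   \sum_(i < n) a (bump 0 i) * b (n - bump 0 i)%N) ?subrK//.
by apply: eq_bigr => i _; rewrite sE//; have := ltn_ord i; lia.
Qed.

Lemma laurent_order (f : laurent) : f != 0 ->
  exists N, f N != 0 /\ lbounded f N.
Proof.
move=> f0; have [M fM] := laurentP f.
have ex : exists k : nat, f (M + k%:Z) != 0.
  apply: contra_neqP f0 => /forallNP h; apply: laurent_ext.
  apply: (@laurent_shift _ _ M) => // k; exact/eqP/negPn/negP/h.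
case: (ex_minnP ex) => k fk kmin; exists (M + k%:Z); split=> // j jk.
have [jM|Mj] := ltP j M; first exact: fM.
apply/eqP/negPn/negP => fj.
have := kmin `|j - M|%N; have -> : M + `|j - M|%N%:Z = j by lia.
by move=> /(_ fj); lia.
Qed.

Lemma laurent_inv_ex (f : laurent) : f != 0 -> exists g : laurent, g * f = 1.
Proof.
move=> /laurent_order[N [fN0 fN]].
have [|b fb] := @pconv_inv (lshift N f); first by rewrite /lshift addr0.
pose g j := if j < - N then 0 else b (absz (j + N)).
have gN : lbounded g (- N) by move=> j jN; rewrite /g jN.
exists (@Laurent g (asboolT (ex_intro _ _ gN))).
rewrite mulrC; apply: laurent_ext.
apply: (@laurent_shift _ _ (N - N)) => [||k].
- exact: lbounded_conv.
- by rewrite subrr; case=> [[|j]|j].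
- rewrite lshift_conv// (eq_pconv (frefl _) (_ : _ =1 b)) ?fb.
    by rewrite /lshift subrr add0r /= coef1.
  move=> i; rewrite /lshift /= /g ifF; last by lia.
  by congr b; lia.
Qed.

(* The inverse is only determined by the equation; 0 is its own inverse. *)
Definition linv (f : laurent) : laurent :=
  if pselect (exists g, g * f = 1) is left h then projT1 (cid h) else 0.

Fact lmulVf f : f != 0 -> linv f * f = 1.
Proof.
by move=> f0; have h := laurent_inv_ex f0; rewrite /linv; case: pselect => // h1; case: cid.
Qed.

Fact linv0 : linv 0 = 0.
Proof.
rewrite /linv; case: pselect => // h; case: h => g h0; exfalso.
by move/eqP: h0; rewrite mulr0 eq_sym oner_eq0.
Qed.

HB.instance Definition _ := GRing.ComNzRing_isField.Build laurent lmulVf linv0.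

End LaurentDef.

Section Carlitz.
Variable F : finFieldType.
Notation K := (laurent F).
Notation q := #|F|.

Definition lX : K := lpoly 'X.

Definition lord (t : K) : int := xget 0 [set N | t N != 0 /\ lbounded t N].

Definition labs (R : realType) (t : K) : R :=
  if t == 0 then 0 else q%:R ^ (- lord t).

Definition lint (R : realType) : set K := [set t | labs R t <= 1].

Definition bracket (j : nat) : K := lX ^+ (q ^ j) - lX.

Definition carlitz_D (i : nat) : K :=
  \prod_(1 <= j < i.+1) bracket j ^+ (q ^ (i - j)).

(* {poly_i F} is the type of polynomials of degree < i, the zero polynomial
   included; for i = 0 the product has the single factor t. *)
Definition carlitz_e (i : nat) (t : K) : K :=
  \prod_(w : {poly_i F}) (t - lpoly w).

Definition carlitz_f (i : nat) (t : K) : K := (carlitz_D i)^-1 * carlitz_e i t.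

End Carlitz.

(* The norms of numdomain satisfy |x *+ n| = |x| *+ n, which excludes positive
   characteristic; hence a separate real-valued absolute value, tied to the
   pseudometric of the field. *)
HB.mixin Record isNonArchAbs (R : realType) C
    & PseudoPointedMetric R C & GRing.Field C := {
  absv : C -> R;
  absv_ge0 : forall a, 0 <= absv a;
  absv_eq0 : forall a, (absv a == 0) = (a == 0);
  absvM : forall a b, absv (a * b) = absv a * absv b;
  absvD : forall a b, absv (a + b) <= Num.max (absv a) (absv b);
  ball_absv : forall (a : C) (e : R) (b : C), ball a e b <-> absv (a - b) < e
}.

#[short(type="completeNonArchFieldType")]
HB.structure Definition CompleteNonArchField (R : realType) :=
  {C of GRing.Field C & Complete C & PseudoPointedMetric R C
   & isNonArchAbs R C}.

Section Functions.
Variables (R : realType) (F : finFieldType) (C : completeNonArchFieldType R).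
Notation K := (laurent F).
Variable iota : K -> C.

Definition continuous_on_lint (v : K -> C) :=
  forall t, lint R t -> forall e : R, 0 < e -> exists2 d : R, 0 < d &
    forall s, lint R s -> labs R (s - t) < d -> absv (v s - v t) < e.

(* For a in the ring of integers and r <= 1 this is a ball of the Laurent
   series field; it is the whole ring of integers as soon as 1 <= r. *)
Definition lball (a : K) (r : R) : set K :=
  [set t | lint R t /\ labs R (t - a) <= r].

Definition analytic_on (B : set K) (v : K -> C) :=
  exists a, B a /\ exists c : nat -> C, forall t, B t ->
    series (fun n => c n * iota (t - a) ^+ n) @ \oo --> v t.

Definition locally_analytic (v : K -> C) :=
  forall a, lint R a -> exists2 r : R, 0 < r & analytic_on (lball a r) v.

Definition carlitz_expansion (c : nat -> C) (v : K -> C) :=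
  c @ \oo --> (0 : C) /\ forall t, lint R t ->
    series (fun i => c i * iota (carlitz_f i t)) @ \oo --> v t.

Definition carlitz_equation (lambda : C) (v : K -> C) :=
  forall t, lint R t -> v (lX F * t) - iota (lX F) * v t = lambda * v t.

Definition ucoef (lambda : C) (n : nat) : C :=
  \prod_(j < n) (lambda - iota (bracket F j)).

Definition usol (t : K) (lambda : C) : C :=
  lim (series (fun n => ucoef lambda n * iota (carlitz_f n t)) @ \oo).

End Functions.

(* Main.v *)
(* Put [z := lambda + x]. Since [f_n(xt) = x^(q^n) f_n(t) + f_(n-1)(t)], the
   function [u := u(., lambda)] is additive and bounded, fixes the constants of
   [F] and satisfies [u(xt) = z u(t)]; these properties determine it: [u] sends
   [\sum_j a_j x^j] to [\sum_j a_j z^j]. Hence [z = x^(q^j)] gives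
   [u(t) = t^(q^j)], [z = 0] gives [u(t) = a_0], and both sides of (iv) evaluate
   [t] at [z^(q^m)]. If [u] is given by a power series [\sum_n c_n t^n] on a ball
   around 0, comparing coefficients in [u(xt) = z u(t)] gives
   [c_n (x^n - z) = 0], so either [z = 0] or [z = x^n] and [u(t) = t^n], and
   additivity makes [n] a power of [q]. *)

Require Import Defs.
From HB Require Import structures.
From mathcomp Require Import all_boot all_order all_algebra all_field zify ring.
From mathcomp Require Import all_classical all_reals topology normedtype sequences.

Set Implicit Arguments.
Unset Strict Implicit.
Unset Printing Implicit Defensive.

Import Order.TTheory GRing.Theory Num.Theory.
Local Open Scope classical_set_scope.
Local Open Scope ring_scope.

(** * Powers of [q] as exponents over a finite field *)

Section FiniteFieldPowers.
Variable F : finFieldType.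
Notation q := #|F|.

(** This is the side condition of [exprDn_pchar]: it makes raising to the power [q ^ m] additive on
    any commutative ring receiving [F]. *)
Lemma card_pchar_nat (L : comNzRingType) (f : {rmorphism F -> L}) m :
  [pchar L].-nat (q ^ m)%N.
Proof.
have [p p_pr pF] := finPcharP F.
rewrite (card_pprimeChar pF) -expnM pnatX; apply/orP; left.
by rewrite (eq_pnat _ (pcharf_eq (rmorph_pchar f pF))) pnat_id.
Qed.

Lemma rmorph_expf_card (L : nzRingType) (f : {rmorphism F -> L}) a m :
  f a ^+ (q ^ m) = f a.
Proof.
rewrite -rmorphXn; congr (f _); elim: m => // m IH.
by rewrite expnS mulnC exprM IH expf_card.
Qed.

(** The factorization of 'X^q - 'X over [F], transported along [f] and evaluated at [y]. *)
Lemma prod_subr_card (L : comNzRingType) (f : {rmorphism F -> L}) (y : L) :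
  \prod_(a : F) (y - f a) = y ^+ q - y.
Proof.
have /(congr1 (fun p => (map_poly f p).[y])) := finField_genPoly F.
rewrite rmorphB /= rmorph_prod map_polyXn map_polyX !hornerE horner_prod => ->.
by apply: eq_bigr => a _; rewrite rmorphB /= map_polyX map_polyC !hornerE.
Qed.

(** Write n = s p^k with s prime to p. Frobenius turns the hypothesis into (1 + Y)^s = 1 + Y^s at Y
    = 'X^(p^k), hence for an indeterminate Y. If s > 1, the derivatives at 0 give s = 0 in [F],
    against coprimality. *)
Lemma additive_expr_pchar p n : p \in [pchar F] -> (0 < n)%N ->
  (1 + 'X) ^+ n = 1 + 'X^n :> {poly F} -> exists s, n = (p ^ s)%N.
Proof.
move=> pF n0 e; have p_pr : prime p := pcharf_prime pF.
have [s pm nE] := pfactor_coprime p_pr n0; exists (logn p n).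
move: e; rewrite {1 2}nE mulnC !exprM.
have pfN : [pchar {poly F}].-nat (p ^ logn p n)%N.
  rewrite pnatX; apply/orP; left.
  by rewrite (eq_pnat _ (pcharf_eq (rmorph_pchar (@polyC F) pF))) pnat_id.
rewrite exprDn_pchar// expr1n => e.
have /eqP : ((1 + 'X) ^+ s - (1 + 'X^s)) \Po 'X^(p ^ logn p n) = 0 :> {poly F}.
  rewrite rmorphB rmorphXn !rmorphD !rmorph1 rmorphXn /= comp_polyX.
  by rewrite e subrr.
rewrite comp_poly_eq0; last first.
  by rewrite size_polyXn ltnS expn_gt0 prime_gt0.
move=> /eqP /(congr1 (fun P => (P^`()).[0])).
rewrite derivB derivD deriv_exp derivD derivX derivXn derivC !hornerE.
rewrite !hornerMn hornerXn horner_exp !hornerE deriv0 horner0 => e1.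
suff s1 : s = 1%N by rewrite {1}nE s1 mul1n.
move: pm; rewrite prime_coprime// (dvdn_pcharf pF).
case: s e1 {nE e} => [|[//|s]]; first by rewrite mulr0n eqxx.
by rewrite /= ?addr0 expr1n exprS mul0r mul0rn subr0 => ->; rewrite eqxx.
Qed.

(** The case a = 1 gives n = p^s; evaluating at 1 then gives a^n = a on all of [F]. With q = p^d,
    reducing s modulo d leaves a^(p^r) = a for some r < d, and counting roots forces r = 0. *)
Lemma linear_expr_card n : (0 < n)%N ->
    (forall a : F, (1 + a%:P * 'X) ^+ n = 1 + a%:P * 'X^n) ->
  exists j, n = (q ^ j)%N.
Proof.
move=> n0 e; have [p p_pr pF] := finPcharP F.
have [|s ns] := additive_expr_pchar pF n0.
  by have := e 1; rewrite !mul1r.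
have [d qE] : exists d, q = (p ^ d)%N by eexists; exact: card_pprimeChar pF.
have d0 : (0 < d)%N.
  by rewrite lt0n; apply/eqP => d0; have := finNzRing_gt1 F; rewrite qE d0.
have an (a : F) : a ^+ n = a.
  have /(congr1 (fun P => P.[1])) := e a.
  have pfN : [pchar F].-nat n.
    by rewrite ns pnatX (eq_pnat _ (pcharf_eq pF)) pnat_id.
  by rewrite horner_exp !hornerE expr1n mulr1 exprDn_pchar// expr1n => /addrI.
exists (s %/ d)%N.
suff r0 : (s %% d)%N = 0%N by rewrite ns {1}(divn_eq s d) r0 addn0 mulnC expnM -qE.
have ar (a : F) : a ^+ (p ^ (s %% d)) = a.
  rewrite -[RHS]an ns {2}(divn_eq s d) expnD exprM; congr (_ ^+ _).
  by rewrite mulnC expnM -qE (rmorph_expf_card idfun).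
apply/eqP/negPn/negP; rewrite -lt0n => r0.
(* If r > 0, this nonzero polynomial has degree p^r < q and yet vanishes on all of [F]. *)
pose P : {poly F} := 'X^(p ^ (s %% d)) - 'X.
have p1 := prime_gt1 p_pr.
have r1 : (1 < p ^ (s %% d))%N by rewrite -{1}(expn0 p) ltn_exp2l.
have sP : size P = (p ^ (s %% d)).+1.
  by rewrite size_polyDl size_polyXn// size_polyN size_polyX.
have P0 : P != 0 by rewrite -size_poly_eq0 sP.
have := max_poly_roots P0 _ (enum_uniq F).
rewrite sP -cardE qE ltnS leq_exp2l// leqNgt ltn_mod d0 => H.
suff : false by []. apply: H.
by apply/allP => a _; rewrite rootE !hornerE ar subrr.
Qed.
End FiniteFieldPowers.

(** * Orders of vanishing and the embedding of polynomials into Laurent series *)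

Section LaurentTheory.
Variable F : finFieldType.
Notation K := (laurent F).
Notation X := (lX F).
Implicit Types (s t : K).

Lemma coefl_sub s t j : (s - t) j = s j - t j.
Proof. by []. Qed.

Fact lpoly_is_zmod_morphism : zmod_morphism (@lpoly F).
Proof.
move=> p r; apply: laurent_ext => -[n|n]; rewrite coefl_sub /= ?subr0//.
exact: coefB.
Qed.

Fact lpoly_is_monoid_morphism : monoid_morphism (@lpoly F).
Proof.
split=> // p r; apply: laurent_ext.
have b (w : {poly F}) : lbounded (lpoly w) 0 by case.
apply: (@laurent_shift _ _ _ 0) => [|| m].
- exact: b.
- by rewrite -[0]addr0; apply: lbounded_conv.
- apply: etrans (esym (lshift_conv (b p) (b r) m)).
  by rewrite /pconv /Defs.lshift !add0r /= coefM; apply: eq_bigr.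
Qed.

HB.instance Definition _ := GRing.isZmodMorphism.Build {poly F} K (@lpoly F)
  lpoly_is_zmod_morphism.
HB.instance Definition _ := GRing.isMonoidMorphism.Build {poly F} K (@lpoly F)
  lpoly_is_monoid_morphism.

Lemma lpoly_inj : injective (@lpoly F).
Proof.
move=> p r e; apply/polyP => n.
by have /(congr1 (fun s : K => s n)) := e.
Qed.

Lemma coef_lXM s j : (X * s) j = s (j - 1).
Proof.
rewrite /GRing.mul /= /conv -(@fsbig_widen int F 0 +%R [set 1])//; last first.
  by move=> [[|[|i]]|i] [_ /= h]; rewrite ?coefX ?mul0r//; case: h.
by rewrite fsbig_set1 /= coefX mul1r.
Qed.

Lemma lX_neq0 : X != 0.
Proof. by rewrite -(rmorph0 (@lpoly F)) (inj_eq lpoly_inj) polyX_eq0. Qed.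

Lemma lbounded_lXM s N : lbounded (X * s) (N + 1) <-> lbounded s N.
Proof.
split=> b j jN; last by rewrite coef_lXM b//; lia.
have -> : s j = (X * s) (j + 1) by rewrite coef_lXM addrK.
by apply: b; lia.
Qed.

Lemma lbounded_lXnM s n N : lbounded (X ^+ n * s) (N + n%:Z) <-> lbounded s N.
Proof.
elim: n N => [|n IH] N; first by rewrite expr0 mul1r addr0.
by rewrite exprS -mulrA -addn1 PoszD addrA lbounded_lXM IH.
Qed.

Lemma lbounded0 N : lbounded (0 : K) N.
Proof. by []. Qed.

Lemma lbounded_lpoly p : lbounded (@lpoly F p) 0.
Proof. by case. Qed.

Lemma lboundedB s t N : lbounded s N -> lbounded t N -> lbounded (s - t) N.
Proof. by move=> sN tN j jN; rewrite coefl_sub sN ?tN ?subr0. Qed.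

Lemma lboundedD s t N : lbounded s N -> lbounded t N -> lbounded (s + t) N.
Proof.
move=> sN tN; rewrite -[t]opprK; apply: lboundedB => // j jN.
by rewrite -[- t]sub0r coefl_sub tN// subr0.
Qed.

Lemma lboundedM s t M N :
  lbounded s M -> lbounded t N -> lbounded (s * t) (M + N).
Proof. exact: lbounded_conv. Qed.

Lemma lboundedX s n : lbounded s 0 -> lbounded (s ^+ n) 0.
Proof.
move=> s0; elim: n => [|n IH]; first exact: lbounded_lpoly.
by rewrite exprS -[0]addr0; apply: lboundedM.
Qed.

Lemma lbounded_lXn n : lbounded (X ^+ n) n.
Proof.
by rewrite -[X ^+ n]mulr1 -[Posz n]add0r lbounded_lXnM; exact: lbounded_lpoly.
Qed.

Lemma lbounded_lX t : lbounded t 0 -> lbounded (X * t) 0.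
Proof.
by move=> t0; apply: (@lbounded_le _ _ _ (0 + 1)) => //; rewrite lbounded_lXM.
Qed.

Lemma lbounded_nat t (n : nat) :
  lbounded t n -> exists2 s : K, lbounded s 0 & t = X ^+ n * s.
Proof.
move=> tn; have X0 : X ^+ n != 0 by rewrite expf_neq0 ?lX_neq0.
exists ((X ^+ n)^-1 * t); last by rewrite mulrA mulfV// mul1r.
by rewrite -(lbounded_lXnM _ n) mulrA mulfV// mul1r add0r.
Qed.

(** Splitting off the constant coefficient is the induction step of every later argument that gains
    one order of precision at a time. *)
Lemma lint_decomp t : lbounded t 0 ->
  exists a : F, exists2 s : K, lbounded s 0 & t = lpoly a%:P + X * s.
Proof.
move=> t0; exists (t 0).
have [|s s0 e] := @lbounded_nat (t - lpoly (t 0)%:P) 1.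
  move=> j j1; rewrite coefl_sub; have [j0|j0] := ltP j 0.
    by rewrite t0// (lbounded_lpoly _ j0)// subr0.
  by have -> : j = 0 by [lia]; rewrite /= coefC subrr.
by exists s => //; rewrite -[X]expr1 -e addrC subrK.
Qed.

End LaurentTheory.

(** * Recursions and integrality of the Carlitz polynomials *)

Section CarlitzPolynomials.
Variable F : finFieldType.
Notation K := (laurent F).
Notation q := #|F|.
Notation X := (lX F).
Notation f := (@carlitz_f F).
Notation cst := (@lpoly F \o @polyC F).
Implicit Types (s t : K) (i : nat).

Lemma finField_card_gt0 : (0 < q)%N.
Proof. exact: ltnW (finNzRing_gt1 F). Qed.

Lemma lX_expr_inj : injective (fun n => X ^+ n).
Proof.
move=> m n /=; rewrite /lX -!rmorphXn => /lpoly_inj/(congr1 (size \o val)) /=.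
by rewrite !size_polyXn => -[].
Qed.

Lemma bracket_neq0 i : bracket F i.+1 != 0.
Proof.
rewrite /bracket subr_eq0 -[X in _ != X]expr1; apply/eqP => /lX_expr_inj.
by apply/eqP; rewrite -[X in _ != X](expn0 q) eqn_exp2l ?finNzRing_gt1.
Qed.

Lemma carlitz_D0 : carlitz_D F 0 = 1.
Proof. by rewrite /carlitz_D big_geq. Qed.

Lemma carlitz_DS i : carlitz_D F i.+1 = bracket F i.+1 * carlitz_D F i ^+ q.
Proof.
rewrite /carlitz_D big_nat_recr //= subnn expn0 expr1 mulrC -prodrXl.
congr (_ * _); rewrite !big_nat; apply: eq_bigr => j /andP[_ ji].
by rewrite -exprM -expnSr; congr (_ ^+ (_ ^ _)%N); lia.
Qed.

Lemma carlitz_D_neq0 i : carlitz_D F i != 0.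
Proof.
elim: i => [|i IH]; first by rewrite carlitz_D0 oner_neq0.
by rewrite carlitz_DS mulf_neq0 ?bracket_neq0 ?expf_neq0.
Qed.

Lemma carlitz_e0 t : carlitz_e 0 t = t.
Proof.
rewrite /carlitz_e (big_pred1 (0 : {poly_0 F})) ?[lpoly _]rmorph0 ?subr0// => w.
by apply/esym/eqP/npolyP => j; rewrite !big_coef_npoly.
Qed.

Lemma carlitz_f0 t : f 0 t = t.
Proof. by rewrite /carlitz_f carlitz_D0 invr1 mul1r carlitz_e0. Qed.

(** A polynomial of degree at most i is uniquely a x^i + w with w of degree less than i; [g] and [h]
    below are the two directions of this bijection. *)
Lemma carlitz_eS i t :
  carlitz_e i.+1 t = \prod_(a : F) carlitz_e i (t - cst a * X ^+ i).
Proof.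
rewrite /carlitz_e pair_big /=.
pose g (aw : F * {poly_i F}) : {poly_i.+1 F} :=
  npolyp i.+1 (aw.1 *: 'X^i + (aw.2 : {poly F})).
have gE aw : g aw = aw.1 *: 'X^i + (aw.2 : {poly F}) :> {poly F}.
  rewrite npolypK// (leq_trans (size_polyD _ _))// geq_max.
  rewrite (leq_trans (size_scale_leq _ _)) ?size_polyXn//=.
  by rewrite (leq_trans (size_npoly _)).
pose h (w : {poly_i.+1 F}) := ((w : {poly F})`_i, npolyp i w : {poly_i F}).
rewrite (reindex g) /=; last first.
  apply: onW_bij; exists h => [[a w]|w].
    rewrite /h gE coefD coefZ coefXn eqxx mulr1 big_coef_npoly// addr0.
    congr (_, _); apply/npolyP => j; rewrite coef_npolyp /=.
    rewrite coefD coefZ coefXn; case: ltnP => ji; last by rewrite big_coef_npoly.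
    by rewrite ltn_eqF// mulr0 add0r.
  apply/val_inj/polyP => j /=; rewrite gE coefD coefZ coefXn /= coef_npolyp.
  case: ltngtP => ji; rewrite ?mulr0 ?add0r ?mulr1 ?addr0 ?ji//.
  by rewrite big_coef_npoly.
apply: eq_bigr => aw _; rewrite gE rmorphD /= opprD addrA.
by rewrite -mul_polyC rmorphM rmorphXn.
Qed.

Lemma lexprD_card s t m : (s + t) ^+ (q ^ m) = s ^+ (q ^ m) + t ^+ (q ^ m).
Proof. by rewrite exprDn_pchar// (card_pchar_nat cst). Qed.

(* The induction is simultaneous: additivity and homogeneity of [f i] turn the
   product formula for [carlitz_e i.+1] into the polynomial [y ^ q - y]. *)
Lemma carlitz_f_linear i :
  [/\ forall s t, f i (s + t) = f i s + f i t,
      forall a t, f i (cst a * t) = cst a * f i t,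
      forall t, f i.+1 t = (f i t ^+ q - f i t) / bracket F i.+1,
      forall t, f i.+1 (X * t) = X ^+ (q ^ i.+1) * f i.+1 t + f i t &
      f i (X ^+ i) = 1].
Proof.
have step j : (forall s t, f j (s + t) = f j s + f j t) ->
    (forall a t, f j (cst a * t) = cst a * f j t) -> f j (X ^+ j) = 1 ->
    forall t, f j.+1 t = (f j t ^+ q - f j t) / bracket F j.+1.
  move=> fD fZ f1 t; have D0 := carlitz_D_neq0 j.
  have eE s : carlitz_e j s = carlitz_D F j * f j s.
    by rewrite /carlitz_f mulrA mulfV// mul1r.
  (* Each factor of the product formula for e_(j+1)(t) becomes D_j (f_j(t) - a), so the product over
     a is D_j^q (f_j(t)^q - f_j(t)). *)
  have fB s a : f j (s - cst a * X ^+ j) = f j s - cst a.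
    by rewrite -mulNr -!rmorphN fD fZ f1 mulr1.
  rewrite {1}/carlitz_f carlitz_eS carlitz_DS.
  under eq_bigr => a _ do rewrite eE fB.
  rewrite big_split /= prodr_const (prod_subr_card cst) invfM.
  by rewrite -mulrA mulKf ?expf_neq0// mulrC.
have qD s t : (s + t) ^+ q = s ^+ q + t ^+ q.
  by have := lexprD_card s t 1; rewrite expn1.
elim: i => [|i [fD fZ fS fX f1]].
  have fD s t : f 0 (s + t) = f 0 s + f 0 t by rewrite !carlitz_f0.
  have fZ a t : f 0 (cst a * t) = cst a * f 0 t by rewrite !carlitz_f0.
  have f1 : f 0 (X ^+ 0) = 1 by rewrite carlitz_f0.
  have fS := step _ fD fZ f1; split=> // t.
  apply: (mulIf (bracket_neq0 0)).
  rewrite mulrDl -[in RHS]mulrA !fS !carlitz_f0 !divfK ?bracket_neq0//.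
  by rewrite exprMn /bracket expn1; ring.
have fSD s t : f i.+1 (s + t) = f i.+1 s + f i.+1 t.
  by rewrite !fS fD qD -mulrDl opprD addrACA.
have fSZ a t : f i.+1 (cst a * t) = cst a * f i.+1 t.
  rewrite !fS fZ exprMn; have := rmorph_expf_card cst a 1; rewrite expn1 => ->.
  by rewrite -mulrBr mulrA.
(* This zero makes the recursion at x * x^i collapse to f_i(x^i) = 1. *)
have fSi0 : f i.+1 (X ^+ i) = 0 by rewrite fS f1 expr1n subrr mul0r.
have fS1 : f i.+1 (X ^+ i.+1) = 1 by rewrite exprS fX fSi0 mulr0 add0r f1.
have fSS := step _ fSD fSZ fS1; split=> // t.
have b0 := bracket_neq0 i.+1; have b1 := bracket_neq0 i.
have fE : f i t ^+ q = f i t + f i.+1 t * bracket F i.+1.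
  by rewrite fS divfK// addrC subrK.
apply: (mulIf b0); rewrite mulrDl -[in RHS]mulrA !fSS !divfK// fX.
rewrite qD exprMn fE -exprM -expnSr /bracket; ring.
Qed.

Lemma carlitz_fD i s t : f i (s + t) = f i s + f i t.
Proof. by case: (carlitz_f_linear i) => + _ _ _ _; apply. Qed.

Lemma carlitz_f_lXM i t : f i.+1 (X * t) = X ^+ (q ^ i.+1) * f i.+1 t + f i t.
Proof. by case: (carlitz_f_linear i) => _ _ _ + _; apply. Qed.

(** Since a^q = a, already f_1 vanishes on constants, and the recursion y^q - y preserves zero. *)
Lemma carlitz_f_const i a : f i.+1 (cst a) = 0.
Proof.
have fS j s : f j.+1 s = (f j s ^+ q - f j s) / bracket F j.+1.
  by case: (carlitz_f_linear j) => _ _ + _ _; apply.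
elim: i => [|i IH]; rewrite fS.
  have := rmorph_expf_card cst a 1; rewrite expn1 carlitz_f0 => ->.
  by rewrite subrr mul0r.
by rewrite IH expr0n gtn_eqF ?finField_card_gt0// subrr mul0r.
Qed.

Lemma lbounded_carlitz_f i t : lbounded t 0 -> lbounded (f i t) 0.
Proof.
elim: i t => [|i IH] t t0; first by rewrite carlitz_f0.
have eB s : lbounded s 0 -> lbounded (carlitz_e i.+1 s) 0.
  move=> s0; rewrite /carlitz_e; apply: (big_ind (fun y : K => lbounded y 0)).
  - exact: lbounded_lpoly.
  - by move=> y z y0 z0; rewrite -[0]addr0; exact: lboundedM.
  - by move=> w _; apply: lboundedB => //; exact: lbounded_lpoly.
have [N DN] := laurentP (carlitz_D F i.+1)^-1.
have : exists M : nat, forall s, lbounded s 0 -> lbounded (f i.+1 s) (- M%:Z).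
  exists `|N|%N => s s0; apply: (@lbounded_le _ _ _ (N + 0)); first by lia.
  by apply: lboundedM => //; exact: eB.
case=> M; elim: M t t0 => [|M IHM] t t0 fM; first by rewrite -oppr0; exact: fM.
apply: IHM => // s /lint_decomp[a [r r0 ->]].
rewrite carlitz_fD carlitz_f_const add0r carlitz_f_lXM; apply: lboundedD.
  apply: (@lbounded_le _ _ _ (- M.+1%:Z + (q ^ i.+1)%N%:Z)).
    by have : (0 < q ^ i.+1)%N; [rewrite expn_gt0 finField_card_gt0 | lia].
  by rewrite lbounded_lXnM; exact: fM.
by apply: (@lbounded_le _ _ _ 0); [lia | exact: IH].
Qed.

End CarlitzPolynomials.

(** * Geometric sequences of real numbers *)

Section GeometricDecay.
Import numFieldNormedType.Exports.

Lemma geom_small (R : realType) (r e B : R) : 0 <= r < 1 -> 0 < e ->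
  exists N, forall n, (N <= n)%N -> r ^+ n * B < e.
Proof.
move=> /andP[r0 r1] e0; have B1 : 0 < `|B| + 1 by rewrite ltr_wpDl.
have rn : `|r| < 1 by rewrite ger0_norm.
have /cvg_ballP /(_ _ (divr_gt0 e0 B1))[N _ hN] := cvg_expr rn.
exists N => n /hN; rewrite /ball /= sub0r normrN ger0_norm ?exprn_ge0//.
rewrite ltr_pdivlMr//; apply: le_lt_trans; apply: ler_wpM2l.
  exact: exprn_ge0.
by rewrite (le_trans (ler_norm _))// lerDl.
Qed.

End GeometricDecay.

(** * The absolute value in terms of the order of vanishing *)

Section LaurentAbs.
Variables (R : realType) (F : finFieldType).
Notation K := (laurent F).
Notation q := #|F|.

Lemma labs_le (t : K) (n : int) : labs R t <= q%:R ^ (- n) <-> lbounded t n.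
Proof.
have q1 : 1 < q%:R :> R by rewrite ltr1n finNzRing_gt1.
rewrite /labs; have [->|t0] := eqVneq t 0.
  by split=> // _; rewrite exprz_ge0// ler0n.
have /(xgetPex 0) := laurent_order t0.
rewrite -/(lord t) => -[tN b]; rewrite ler_eXz2l// lerN2; split=> [nt|tn].
  by move: b; exact: lbounded_le.
by rewrite leNgt; apply/negP => h; move: tN; rewrite tn// eqxx.
Qed.

Lemma lintE (t : K) : lint R t <-> lbounded t 0.
Proof. by rewrite -labs_le oppr0 expr0z. Qed.

End LaurentAbs.

(** * Limits and series in a complete non-archimedean field *)

Section NonArchSeries.
Variables (R : realType) (C : completeNonArchFieldType R).
Implicit Types (x y z l : C) (a b s : nat -> C) (e : R).

Lemma absv0 : absv (0 : C) = 0 :> R.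
Proof. by apply/eqP; rewrite absv_eq0. Qed.

Lemma absv1 : absv (1 : C) = 1 :> R.
Proof.
have n0 : absv (1 : C) != 0 :> R by rewrite absv_eq0 oner_neq0.
by apply: (mulfI n0); rewrite -absvM !mulr1.
Qed.

(** The square of the absolute value of -1 is 1. *)
Lemma absvN x : absv (- x) = absv x :> R.
Proof.
rewrite -mulN1r absvM; suff -> : absv (-1 : C) = 1 :> R by rewrite mul1r.
apply/eqP; rewrite -(@eqrXn2 _ 2)// ?absv_ge0//.
by rewrite expr2 -absvM mulrNN mulr1 absv1 expr1n.
Qed.

Lemma absvX x n : absv (x ^+ n) = absv x ^+ n :> R.
Proof.
by elim: n => [|n IH]; rewrite ?expr0 ?absv1// !exprS absvM IH.
Qed.

Lemma absvD_le x y (B : R) : absv x <= B -> absv y <= B -> absv (x + y) <= B.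
Proof. by move=> xB yB; rewrite (le_trans (absvD _ _))// ge_max xB. Qed.

Lemma absvD_lt x y e : absv x < e -> absv y < e -> absv (x + y) < e.
Proof. by move=> xB yB; rewrite (le_lt_trans (absvD _ _))// gt_max xB. Qed.

Lemma absvBC x y : absv (x - y) = absv (y - x) :> R.
Proof. by rewrite -absvN opprB. Qed.

Lemma absv_lt_eq0 x : (forall e, 0 < e -> absv x < e) -> x = 0.
Proof.
move=> h; apply/eqP; rewrite -absv_eq0 eq_le absv_ge0 andbT leNgt.
by apply/negP => /h; rewrite ltxx.
Qed.

Lemma absv_geom_eq0 x z (B : R) : absv z < 1 ->
  (forall n, absv x <= absv z ^+ n * B) -> x = 0.
Proof.
move=> z1 h; apply: absv_lt_eq0 => e e0.
have [|N hN] := @geom_small R (absv z) e B _ e0; first by rewrite absv_ge0.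
exact: le_lt_trans (h N) (hN N (leqnn N)).
Qed.

Lemma cvg_absvP s l : (s @ \oo --> l) <->
  forall e, 0 < e -> exists N, forall n, (N <= n)%N -> absv (s n - l) < e.
Proof.
split=> [/cvg_ballP h e e0|h].
  have [N _ hN] := h e e0; exists N => n Nn.
  by rewrite absvBC; apply/ball_absv/hN.
apply/cvg_ballP => e /h[N hN]; exists N => // n /= Nn.
by apply/ball_absv; rewrite absvBC; exact: hN.
Qed.

(** Points are separated by [absv_eq0]; a pseudometric alone would not give this. *)
Lemma cvg_absv_unique s l l' : s @ \oo --> l -> s @ \oo --> l' -> l = l'.
Proof.
move=> /cvg_absvP h /cvg_absvP h'; apply/eqP; rewrite -subr_eq0; apply/eqP.
apply: absv_lt_eq0 => e e0; have [N hN] := h e e0; have [M hM] := h' e e0.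
have -> : l - l' = - (s (N + M)%N - l) + (s (N + M)%N - l') by ring.
by apply: absvD_lt; rewrite ?absvN ?hN ?hM ?leq_addr ?leq_addl.
Qed.

Lemma cvg_absvD s s' l l' :
  s @ \oo --> l -> s' @ \oo --> l' -> (fun n => s n + s' n) @ \oo --> l + l'.
Proof.
move=> /cvg_absvP h /cvg_absvP h'; apply/cvg_absvP => e e0.
have [N hN] := h e e0; have [M hM] := h' e e0; exists (N + M)%N => n NMn.
have -> : s n + s' n - (l + l') = (s n - l) + (s' n - l') by ring.
by apply: absvD_lt; [apply: hN | apply: hM]; lia.
Qed.

Lemma cvg_absvMl x s l : s @ \oo --> l -> (fun n => x * s n) @ \oo --> x * l.
Proof.
move=> /cvg_absvP h; apply/cvg_absvP => e e0.
have x0 : 0 < absv x + 1 by rewrite ltr_wpDl// absv_ge0.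
have [N hN] := h _ (divr_gt0 e0 x0); exists N => n /hN.
rewrite -mulrBr absvM ltr_pdivlMr// => he.
by rewrite mulrC (le_lt_trans _ he)// ler_wpM2l ?absv_ge0// lerDl.
Qed.

Lemma absv_seriesB_le a (B : R) m n : (m <= n)%N ->
    (forall k, (m <= k < n)%N -> absv (a k) <= B) -> 0 <= B ->
  absv (series a n - series a m) <= B.
Proof.
move=> mn aB B0; rewrite sub_series_geq// big_nat.
apply: (big_ind (fun x => absv x <= B)) => //; first by rewrite absv0.
by move=> x y; exact: absvD_le.
Qed.

(** If the limit exceeded [B], a partial sum closer to it than its own absolute value would also
    exceed [B], against the ultrametric inequality. *)
Lemma absv_series_lim_le a l (B : R) : series a @ \oo --> l ->
  (forall k, absv (a k) <= B) -> absv l <= B.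
Proof.
move=> /cvg_absvP h aB; have B0 : 0 <= B := le_trans (absv_ge0 _) (aB 0%N).
rewrite leNgt; apply/negP => Bl; have [N hN] := h _ (le_lt_trans B0 Bl).
suff : absv (series a N - (series a N - l)) < absv l by rewrite subKr ltxx.
apply: absvD_lt; last by rewrite absvN hN.
rewrite (le_lt_trans _ Bl)// -[series a N]subr0 -(_ : series a 0%N = 0).
  exact: absv_seriesB_le.
by rewrite /series /= big_geq.
Qed.

(** By the ultrametric inequality, a block of consecutive terms is no larger than its largest term,
    so the partial sums are Cauchy as soon as the terms tend to 0. *)
Lemma cvg_series_absv a : a @ \oo --> (0 : C) -> exists l, series a @ \oo --> l.
Proof.
move=> /cvg_absvP h; exists (lim (series a @ \oo)); apply: cauchy_cvg.
apply/cauchy_ballP => e e0; have [N hN] := h _ (divr_gt0 e0 (ltr0Sn R 1)).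
pose A := [set series a n | n in [set n | (N <= n)%N]].
exists (A, A) => /=; first by split; exists N => // n /= Nn; exists n.
have small m n : (N <= m <= n)%N -> absv (series a n - series a m) < e.
  move=> /andP[Nm mn]; apply: (@le_lt_trans _ _ (e / 2)); last first.
    by rewrite ltr_pdivrMr// ltr_pMr// ltr1n.
  apply: absv_seriesB_le => // [k /andP[mk _]|]; last by rewrite divr_ge0// ltW.
  by have := hN k (leq_trans Nm mk); rewrite subr0 => /ltW.
move=> [_ _] /= [[m Nm <-] [n Nn <-]]; apply/ball_absv; move: Nm Nn => /= Nm Nn.
have [mn|/ltnW nm] := leqP m n; last by apply: small; rewrite Nn.
by rewrite absvBC; apply: small; rewrite Nm.
Qed.

Lemma series_cvg0 a l : series a @ \oo --> l -> a @ \oo --> (0 : C).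
Proof.
move=> /cvg_absvP h; apply/cvg_absvP => e /h[N hN]; exists N => n Nn.
have -> : a n - 0 = (series a n.+1 - l) - (series a n - l).
  by rewrite seriesEnat /= big_nat_recr //=; ring.
by apply: absvD_lt; rewrite ?absvN hN// leqW.
Qed.

Lemma cvg0_bounded a : a @ \oo --> (0 : C) ->
  exists B : R, forall n, absv (a n) <= B.
Proof.
move=> /cvg_absvP /(_ 1 ltr01)[N hN].
exists (1 + \sum_(k < N) absv (a k)) => n.
have S0 : 0 <= \sum_(k < N) absv (a k) by apply: sumr_ge0 => k _; exact: absv_ge0.
have [nN|Nn] := ltnP n N.
  rewrite (bigD1 (Ordinal nN))//= addrCA lerDl addr_ge0// sumr_ge0// => k _.
  exact: absv_ge0.
by have := ltW (hN n Nn); rewrite subr0 => /le_trans; apply; rewrite lerDl.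
Qed.

Lemma series_telescope b :
  b @ \oo --> (0 : C) -> series (fun n => b n - b n.+1) @ \oo --> b 0%N.
Proof.
move=> /cvg_absvP h; apply/cvg_absvP => e /h[N hN]; exists N => n Nn.
have -> : series (fun n => b n - b n.+1) n - b 0%N = - (b n - 0).
  rewrite seriesEnat /= (eq_bigr (fun k => - b k.+1 - - b k)).
    by rewrite (telescope_sumr (fun k => - b k))//; ring.
  by move=> k _; rewrite opprK addrC.
by rewrite absvN hN.
Qed.

Lemma cvg_seriesD a b l l' : series a @ \oo --> l -> series b @ \oo --> l' ->
  series (fun n => a n + b n) @ \oo --> l + l'.
Proof.
have -> : series (fun n => a n + b n) = (fun n => series a n + series b n).
  by apply/funext => n; rewrite !seriesEnat /= big_split.
exact: cvg_absvD.
Qed.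

Lemma cvg_seriesMl x a l : series a @ \oo --> l ->
  series (fun n => x * a n) @ \oo --> x * l.
Proof.
have -> : series (fun n => x * a n) = (fun n => x * series a n).
  by apply/funext => n; rewrite !seriesEnat /= mulr_sumr.
exact: cvg_absvMl.
Qed.

Lemma series_eventually0 a m : (forall n, (m <= n)%N -> a n = 0) ->
  series a @ \oo --> series a m.
Proof.
move=> a0; apply/cvg_absvP => e e0; exists m => n mn.
by rewrite sub_series_geq// big_nat big1 ?absv0// => k /andP[mk _]; exact: a0.
Qed.

End NonArchSeries.

(** * Maps substituting z for x, and their analyticity *)

Section Substitution.
Variables (R : realType) (F : finFieldType) (C : completeNonArchFieldType R).
Notation K := (laurent F).
Notation q := #|F|.
Notation X := (lX F).
Notation cst := (@lpoly F \o @polyC F).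
Variable iota : {rmorphism K -> C}.
Hypothesis iota_abs : forall t : K, absv (iota t) = labs R t.
Implicit Types (s t : K) (z l : C) (v w : K -> C).

Lemma absv_iota_le t (n : int) : absv (iota t) <= q%:R ^ (- n) <-> lbounded t n.
Proof. by rewrite iota_abs; exact: labs_le. Qed.

Lemma absv_iota_le1 t : lbounded t 0 -> absv (iota t) <= 1.
Proof. by rewrite -absv_iota_le oppr0 expr0z. Qed.

Lemma card_inv_lt1 : q%:R^-1 < 1 :> R.
Proof. by rewrite invf_lt1 ?ltr0n ?finField_card_gt0// ltr1n finNzRing_gt1. Qed.

Lemma absv_iota_lt1 t : lbounded t 1 -> absv (iota t) < 1.
Proof.
rewrite -absv_iota_le => /le_lt_trans; apply.
by rewrite exprN1; exact: card_inv_lt1.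
Qed.

Lemma lbounded_bracket j : lbounded (bracket F j) 1.
Proof.
apply: lboundedB; last by rewrite -[lX F]expr1; exact: lbounded_lXn.
apply: (@lbounded_le _ _ _ (q ^ j)%N); last exact: lbounded_lXn.
by have : (0 < q ^ j)%N by [rewrite expn_gt0 finField_card_gt0]; lia.
Qed.

Lemma absv_iotaX_lt1 : absv (iota X) < 1.
Proof. by apply: absv_iota_lt1; rewrite -[lX F]expr1; exact: lbounded_lXn. Qed.

Lemma absv_iotaX_gt0 : 0 < absv (iota X) :> R.
Proof. by rewrite lt0r absv_ge0 absv_eq0 fmorph_eq0 lX_neq0. Qed.

(* On the ring of integers, these conditions say that [w] maps
   [\sum_j a_j x^j] to [\sum_j a_j z^j]. *)
Definition substitution z w :=
  [/\ forall s t, lbounded s 0 -> lbounded t 0 -> w (s + t) = w s + w t,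
      forall t, lbounded t 0 -> w (X * t) = z * w t,
      forall a, w (cst a) = iota (cst a) &
      exists B : R, forall t, lbounded t 0 -> absv (w t) <= B].

Lemma substitution_lXnM z w n t : substitution z w -> lbounded t 0 ->
  w (X ^+ n * t) = z ^+ n * w t.
Proof.
move=> [_ wX _ _] t0; elim: n => [|n IH]; first by rewrite !expr0 !mul1r.
rewrite exprS -mulrA wX ?IH ?exprS ?mulrA//.
rewrite -[0]addr0; apply: lboundedM => //.
by apply: (@lbounded_le _ _ _ n) => //; exact: lbounded_lXn.
Qed.

Lemma substitution1 z w : substitution z w -> w 1 = 1.
Proof. by move=> [_ _ /(_ 1) + _] /=; rewrite !rmorph1. Qed.

(** Both maps agree on the constant coefficient, so removing it extracts a factor z from the
    difference. After n rounds the difference is at most |z|^n times a common bound. *)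
Lemma substitution_unique z w w' t : absv z < 1 ->
  substitution z w -> substitution z w' -> lbounded t 0 -> w t = w' t.
Proof.
move=> z1 [wD wX w1 [B wB]] [wD' wX' w1' [B' wB']] t0.
apply/eqP; rewrite -subr_eq0; apply/eqP.
apply: (@absv_geom_eq0 _ _ _ z (Num.max B B') z1) => n.
elim: n t t0 => [|n IH] t t0.
  rewrite expr0 mul1r; apply: absvD_le; rewrite ?absvN le_max.
    by rewrite wB.
  by rewrite wB' ?orbT.
have [a [s s0 ->]] := lint_decomp t0.
have a0 := lbounded_lpoly a%:P.
have Xs0 : lbounded (X * s) 0 by exact: lbounded_lX.
rewrite wD// wD'// (w1 a) (w1' a) wX// wX'// opprD addrACA subrr add0r.
by rewrite -mulrBr absvM exprS -mulrA ler_wpM2l ?absv_ge0// IH.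
Qed.

(** Increments divisible by x^N are mapped to values of size at most |z|^N [B]. *)
Lemma substitution_continuous z w : absv z < 1 -> substitution z w ->
  continuous_on_lint w.
Proof.
move=> z1 sw t /lintE t0 e e0; have [wD _ _ [B wB]] := sw.
have [|N hN] := @geom_small R (absv z) e B _ e0; first by rewrite absv_ge0.
exists (q%:R ^ (- N%:Z)); first by rewrite exprz_gt0// ltr0n finField_card_gt0.
move=> s /lintE s0 /ltW /labs_le /lbounded_nat[r r0 sE].
have -> : s = t + X ^+ N * r by rewrite -sE addrC subrK.
have Xr : lbounded (X ^+ N * r) 0.
  by rewrite -sE; exact: lboundedB.
rewrite wD// addrC addKr (substitution_lXnM _ sw)// absvM absvX.
rewrite (le_lt_trans _ (hN N (leqnn N)))// ler_wpM2l ?exprn_ge0 ?absv_ge0//.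
exact: wB.
Qed.

(** Evaluation at the points x^k suffices. If the coefficients below m vanish, the term of index m
    balances a tail of size at most r^(k(m+1)) [B] with r = |x|, so |d_m| <= r^k [B] for every k.
    The bound [B] comes from convergence at 1. *)
Lemma power_series_eq0 (d : nat -> C) :
    (forall s, lbounded s 0 ->
      series (fun n => d n * iota s ^+ n) @ \oo --> (0 : C)) ->
  forall n, d n = 0.
Proof.
move=> h; have one0 : lbounded (1 : K) 0 by exact: (lbounded_lpoly (1 : {poly F})).
have [B dB] : exists B : R, forall n, absv (d n) <= B.
  have [B hB] := cvg0_bounded (series_cvg0 (h 1 one0)).
  by exists B => n; have := hB n; rewrite rmorph1 expr1n mulr1.
elim/ltn_ind => m IH.
apply: (@absv_geom_eq0 _ _ _ (iota X) B absv_iotaX_lt1) => k.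
set r := absv (iota X); have r0 : 0 < r := absv_iotaX_gt0.
have Xk : lbounded (X ^+ k) 0.
  by apply: (@lbounded_le _ _ _ k) => //; exact: lbounded_lXn.
pose a n := d n * iota (X ^+ k) ^+ n.
(* Adding [b] deletes the term of index m, so the remaining terms sum to its opposite. *)
pose b n := if n == m then - a n else 0.
have bE : series b m.+1 = - a m.
  rewrite seriesEnat /= big_nat_recr //= big_nat big1 ?add0r /b ?eqxx// => n.
  by move=> /andP[_ nm]; rewrite ltn_eqF.
have hb : series b @ \oo --> - a m.
  rewrite -bE; apply: series_eventually0 => n mn.
  by rewrite /b gtn_eqF.
have := cvg_seriesD (h _ Xk) hb; rewrite add0r => /absv_series_lim_le.
have rX n : absv (iota (X ^+ k) ^+ n) = r ^+ (k * n).
  by rewrite -rmorphXn -exprM rmorphXn absvX.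
move=> /(_ (r ^+ (k * m) * (r ^+ k * B))) H.
have : absv (- a m) <= r ^+ (k * m) * (r ^+ k * B).
  apply: H => n; rewrite /b; case: ltngtP => nm.
  - rewrite IH// mul0r addr0 absv0 !mulr_ge0 ?exprn_ge0 ?(ltW r0)//.
    exact: le_trans (absv_ge0 _) (dB 0%N).
  - rewrite addr0 absvM rX mulrA -exprD addnC -mulnS mulrC.
    apply: ler_pM; rewrite ?absv_ge0 ?exprn_ge0 ?(ltW r0)//.
    apply: ler_wiXn2l; rewrite ?(ltW r0) ?(ltW absv_iotaX_lt1)//.
    by rewrite leq_mul2l nm orbT.
  - rewrite nm addrN absv0 !mulr_ge0 ?exprn_ge0 ?(ltW r0)//.
    exact: le_trans (absv_ge0 _) (dB 0%N).
by rewrite absvN absvM rX mulrC ler_pM2l// exprn_gt0.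
Qed.

(* Comparing [w (x t) = z * w t] coefficientwise leaves at most one monomial,
   and additivity forces its exponent to be a power of [q]. *)
Lemma analytic_substitution z w N b (c : nat -> C) :
    absv z < 1 -> substitution z w ->
    (forall s, lbounded s 0 ->
      series (fun n => c n * iota (X ^+ N * s) ^+ n) @ \oo -->
        w b + w (X ^+ N * s)) ->
  (exists j, z = iota (X ^+ (q ^ j))) \/ z = 0 /\ (0 < N)%N.
Proof.
move=> z1 sw h; have [wD wX w1 _] := sw.
have one0 : lbounded (1 : K) 0 by exact: (lbounded_lpoly (1 : {poly F})).
(* [e] removes the constant [w b], and [c'] absorbs the scaling by x^N: the new series in s
   represents w(x^N s) = z^N w(s), called [g]. *)
pose e n := if n == 0%N then - w b else 0.
pose c' n := (c n + e n) * iota X ^+ (N * n).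
pose g s := z ^+ N * w s.
have hg s : lbounded s 0 -> series (fun n => c' n * iota s ^+ n) @ \oo --> g s.
  move=> s0; have he : series e @ \oo --> - w b.
    have -> : - w b = series e 1 by rewrite seriesEnat /= big_nat1.
    by apply: series_eventually0; case.
  rewrite (_ : (fun n => _) =
      (fun n => c n * iota (X ^+ N * s) ^+ n + e n)); last first.
    apply/funext => n.
    rewrite /c' rmorphM rmorphXn exprMn -exprM -mulrA mulrDl; congr (_ + _).
    by rewrite /e; case: n => [|n]; rewrite ?mul0r// muln0 !expr0 !mulr1.
  have := cvg_seriesD (h _ s0) he.
  by rewrite addrAC addrN add0r (substitution_lXnM _ sw).
(* These are the coefficients of g(xs) - z g(s), which vanishes identically. *)
have c'0 n : c' n * (iota X ^+ n - z) = 0.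
  apply: (@power_series_eq0 (fun n => c' n * (iota X ^+ n - z))) => s s0.
  have Xs0 : lbounded (X * s) 0 by exact: lbounded_lX.
  rewrite (_ : (fun k => _) =
      (fun k => c' k * iota (X * s) ^+ k + - z * (c' k * iota s ^+ k))); last first.
    by apply/funext => k; rewrite rmorphM exprMn; ring.
  have := cvg_seriesD (hg _ Xs0) (cvg_seriesMl (x := - z) (hg _ s0)).
  by rewrite /g wX// mulrCA -mulrDl addrN mul0r.
(* If z is no power of x, every [c'] vanishes, so g(1) = z^N is 0; this forces z = 0 and N > 0. *)
have [[n zn]|nz] := pselect (exists n, z = iota X ^+ n); last first.
  right; have c0 n : c' n = 0.
    have /eqP := c'0 n; rewrite mulf_eq0 => /orP[/eqP//|].
    by rewrite subr_eq0 => /eqP zn; case: nz; exists n.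
  have : g 1 = 0.
    apply: (cvg_absv_unique (hg 1 one0)).
    rewrite (_ : (fun n => _) = (fun=> 0)).
      rewrite -[X in _ --> X](_ : series (fun=> 0 : C) 0 = 0).
        exact: series_eventually0.
      by rewrite seriesEnat /= big_geq.
    by apply/funext => n; rewrite c0 mul0r.
  rewrite /g (substitution1 sw) mulr1 => /eqP.
  by rewrite expf_eq0 => /andP[N0 /eqP].
left; have z0 : z != 0 by rewrite zn expf_neq0// fmorph_eq0 lX_neq0.
have c0 m : m != n -> c' m = 0.
  move=> mn; have /eqP := c'0 m; rewrite mulf_eq0 => /orP[/eqP//|].
  rewrite subr_eq0 zn -!(rmorphXn iota) => /eqP/fmorph_inj e'.
  by rewrite (lX_expr_inj e') eqxx in mn.
have gE s : lbounded s 0 -> g s = c' n * iota s ^+ n.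
  move=> s0; apply: (cvg_absv_unique (hg s s0)).
  rewrite (_ : c' n * _ = series (fun m => c' m * iota s ^+ m) n.+1).
    by apply: series_eventually0 => m nm; rewrite c0 ?mul0r// gtn_eqF.
  rewrite seriesEnat /= big_nat_recr //= big_nat big1 ?add0r// => m.
  by move=> /andP[_ mn]; rewrite c0 ?mul0r// ltn_eqF.
(* The remaining coefficient is z^N, as evaluation at 1 shows. *)
have wE s : lbounded s 0 -> w s = iota s ^+ n.
  move=> s0; apply: (mulfI (expf_neq0 N z0)); rewrite -/(g s) gE//.
  congr (_ * _); have := gE 1 one0.
  by rewrite rmorph1 expr1n mulr1 /g (substitution1 sw) mulr1.
have n0 : (0 < n)%N.
  by case: n zn {c0 gE wE} => // zn; move: z1; rewrite zn expr0 absv1 ltxx.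
have [|j nj] := @linear_expr_card F n n0; last first.
  by exists j; rewrite zn nj rmorphXn.
(* Additivity of [w] on 1 and x a reads (1 + a x)^n = 1 + a x^n, since w(x a) = z a with z = x^n. *)
move=> a; apply: lpoly_inj; apply: (fmorph_inj iota).
have a0 := lbounded_lpoly a%:P.
have Xa0 : lbounded (X * lpoly a%:P) 0 by exact: lbounded_lX.
rewrite !(rmorphD, rmorphM, rmorphXn, rmorph1) /=.
have := wD 1 _ one0 Xa0; rewrite wE; last exact: lboundedD.
rewrite (wX _ a0) (w1 a) (substitution1 sw) zn.
by rewrite rmorphD rmorphM rmorph1 [iota X * _]mulrC [iota X ^+ n * _]mulrC.
Qed.

End Substitution.

(** * Carlitz expansions and the properties of [usol] *)

Section Expansion.
Variables (R : realType) (F : finFieldType) (C : completeNonArchFieldType R).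
Notation K := (laurent F).
Notation q := #|F|.
Notation X := (lX F).
Notation cst := (@lpoly F \o @polyC F).
Notation f := (@carlitz_f F).
Variable iota : {rmorphism K -> C}.
Hypothesis iota_abs : forall t : K, absv (iota t) = labs R t.
Implicit Types (s t : K) (l : C) (v w : K -> C).

(** Additivity passes through termwise, the value at a constant reduces to c_0 f_0, and integrality
    of the f_n bounds the sum by a bound on the coefficients. *)
Lemma expansion_substitution (c : nat -> C) l v : carlitz_expansion iota c v ->
  c 0%N = 1 -> carlitz_equation iota l v -> substitution iota (l + iota X) v.
Proof.
move=> [cc ch] c0 ce.
have vh t : lbounded t 0 -> series (fun n => c n * iota (f n t)) @ \oo --> v t.
  by move=> /(lintE R)/ch.
split=> [s t s0 t0|t t0|a|].
- apply: (cvg_absv_unique (vh _ (lboundedD s0 t0))).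
  have := cvg_seriesD (vh _ s0) (vh _ t0).
  rewrite [X in series X](_ : _ = fun n => c n * iota (f n (s + t)))//.
  by apply/funext => n; rewrite carlitz_fD rmorphD mulrDr.
- have /eqP := ce t (proj2 (lintE R _) t0).
  by rewrite subr_eq => /eqP ->; rewrite mulrDl.
- have a0 := lbounded_lpoly a%:P; apply: (cvg_absv_unique (vh _ a0)).
  rewrite (_ : iota (cst a) = series (fun n => c n * iota (f n (cst a))) 1).
    apply: series_eventually0 => -[|n] // _.
    by rewrite carlitz_f_const rmorph0 mulr0.
  by rewrite seriesEnat /= big_nat1 c0 mul1r carlitz_f0.
- have [B cB] := cvg0_bounded cc; exists B => t t0.
  apply: (absv_series_lim_le (vh _ t0)) => n.
  rewrite absvM -[B]mulr1 ler_pM ?absv_ge0//.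
  by apply: absv_iota_le1 => //; exact: lbounded_carlitz_f.
Qed.

Lemma cvg_term_carlitz (c : nat -> C) t : c @ \oo --> (0 : C) -> lbounded t 0 ->
  (fun n => c n * iota (f n t)) @ \oo --> (0 : C).
Proof.
move=> /cvg_absvP h t0; apply/cvg_absvP => e /h[N hN]; exists N => n /hN.
rewrite !subr0 absvM; apply: le_lt_trans; rewrite -[leRHS]mulr1.
rewrite ler_wpM2l ?absv_ge0//.
by apply: absv_iota_le1 => //; exact: lbounded_carlitz_f.
Qed.

Lemma ucoefS l n : ucoef iota l n.+1 = ucoef iota l n * (l - iota (bracket F n)).
Proof. by rewrite /ucoef big_ord_recr. Qed.

(** Every factor [l] - [j] has absolute value at most max(|l|, 1/q) < 1. *)
Lemma cvg_ucoef l : absv l < 1 -> ucoef iota l @ \oo --> (0 : C).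
Proof.
move=> l1; set r : R := Num.max (absv l) q%:R^-1.
have r0 : 0 <= r by rewrite le_max absv_ge0.
have r1 : r < 1 by rewrite gt_max l1 card_inv_lt1.
have cr n : absv (ucoef iota l n) <= r ^+ n.
  elim: n => [|n IH]; first by rewrite /ucoef big_ord0 absv1.
  rewrite ucoefS absvM exprSr ler_pM ?absv_ge0//.
  apply: absvD_le; rewrite ?absvN le_max ?lexx// orbC.
  by have := proj2 (absv_iota_le iota_abs _ 1) (lbounded_bracket F n);
    rewrite exprN1 => ->.
apply/cvg_absvP => e e0; have [|N hN] := @geom_small R r e 1 _ e0.
  by rewrite r0.
by exists N => n /hN; rewrite mulr1 subr0; apply: le_lt_trans.
Qed.

(** Convergence ensures that the [lim] in [usol] is a genuine limit, not a default value. *)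
Lemma usol_expansion l : absv l < 1 ->
  carlitz_expansion iota (ucoef iota l) (fun t => usol iota t l).
Proof.
move=> l1; have c0 := cvg_ucoef l1; split=> // t /lintE t0.
have [v vh] := cvg_series_absv (cvg_term_carlitz c0 t0).
exact: (cvgP _ vh).
Qed.

Lemma usol_equation l : absv l < 1 ->
  carlitz_equation iota l (fun t => usol iota t l).
Proof.
move=> l1 t /lintE t0; have [c0 uh] := usol_expansion l1.
set c := ucoef iota l in c0 uh.
have h0 := uh t (proj2 (lintE R t) t0).
have hX := uh _ (proj2 (lintE R _) (lbounded_lX t0)).
set u1 := usol _ _ _ in h0; set uX := usol _ _ _ in hX.
rewrite -/u1 -/uX.
(* With b_n = c_n f_(n-1)(t) and b_0 = 0, the recursions for f_n(xt) and c_(n+1) turn c_n f_n(xt) -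
   (x + l) c_n f_n(t) into b_n - b_(n+1), so the sum telescopes to 0. *)
pose b n := if n is n'.+1 then c n * iota (f n' t) else 0.
have b0 : b @ \oo --> (0 : C).
  have /cvg_absvP h := cvg_term_carlitz c0 t0.
  apply/cvg_absvP => e /h[N hN]; exists N.+1 => -[|n] // Nn.
  rewrite /= subr0 /c ucoefS -/c mulrAC absvM.
  have := hN n Nn; rewrite subr0; apply: le_lt_trans.
  rewrite -[leRHS]mulr1 ler_wpM2l ?absv_ge0//; apply: absvD_le.
    exact: ltW.
  by rewrite absvN ltW// absv_iota_lt1//; exact: lbounded_bracket.
have hb := series_telescope b0.
have hx := cvg_seriesMl (x := - (iota X + l)) h0.
have := cvg_seriesD hX hx.
rewrite (_ : (fun n => _) = (fun n => b n - b n.+1)); last first.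
  apply/funext => -[|n] /=.
    rewrite !carlitz_f0 /c ucoefS -/c /bracket expn0 expr1 subrr rmorph0 rmorphM.
    ring.
  rewrite carlitz_f_lXM [c n.+2]ucoefS -/c /bracket.
  by rewrite rmorphD rmorphM rmorphB; ring.
move=> /(cvg_absv_unique hb) /esym /eqP.
by rewrite /= mulNr subr_eq0 => /eqP ->; ring.
Qed.

Lemma usol_substitution l : absv l < 1 ->
  substitution iota (l + iota X) (fun t => usol iota t l).
Proof.
move=> l1; apply: expansion_substitution (usol_expansion l1) _ (usol_equation l1).
by rewrite /ucoef big_ord0.
Qed.

Lemma absv_addX_lt1 l : absv l < 1 -> absv (l + iota X) < 1.
Proof. by move=> l1; apply: absvD_lt => //; exact: absv_iotaX_lt1. Qed.

Lemma usol_unique l (c : nat -> C) v : absv l < 1 ->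
    carlitz_expansion iota c v -> c 0%N = 1 -> carlitz_equation iota l v ->
  forall t, lint R t -> v t = usol iota t l.
Proof.
move=> l1 vc c0 ve t /lintE t0.
apply: (substitution_unique (w' := usol iota ^~ l) (absv_addX_lt1 l1)) => //.
  exact: expansion_substitution vc c0 ve.
exact: usol_substitution.
Qed.

Lemma substitution_card w z m : substitution iota z w ->
  substitution iota (z ^+ (q ^ m)) (fun t => w (t ^+ (q ^ m))).
Proof.
move=> sw; have [wD wX w1 [B wB]] := sw; split=> [s t s0 t0|t t0|a|].
- by rewrite lexprD_card wD//; exact: lboundedX.
- by rewrite exprMn (substitution_lXnM _ sw)//; exact: lboundedX.
- by rewrite rmorph_expf_card w1.
- by exists B => t t0; rewrite wB//; exact: lboundedX.
Qed.

Lemma substitution_iota : substitution iota (iota X) iota.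
Proof.
split=> [s t _ _|t _|//|]; rewrite ?rmorphD ?rmorphM//.
by exists 1 => t; exact: absv_iota_le1.
Qed.

(** Since [j] + x = x^(q^j), both sides substitute x^(q^j) for x. *)
Lemma usol_bracket j t : lbounded t 0 ->
  usol iota t (iota (bracket F j)) = iota (t ^+ (q ^ j)).
Proof.
have b1 : absv (iota (bracket F j)) < 1.
  by apply: absv_iota_lt1 => //; exact: lbounded_bracket.
apply: (substitution_unique (w := usol iota ^~ _)
  (w' := fun s => iota (s ^+ (q ^ j))) (absv_addX_lt1 b1)) => //.
  exact: usol_substitution.
rewrite -rmorphD /bracket subrK rmorphXn.
exact: (substitution_card j substitution_iota).
Qed.

(** Both sides substitute (l + x)^(q^m) for x, because l^(q^m) + [m] + x = l^(q^m) + x^(q^m). *)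
Lemma usol_card l m t : absv l < 1 -> lbounded t 0 ->
  usol iota (t ^+ (q ^ m)) l
  = usol iota t (l ^+ (q ^ m) + iota (bracket F m)).
Proof.
move=> l1 t0; have l1' : absv (l ^+ (q ^ m) + iota (bracket F m)) < 1.
  apply: absvD_lt; last by apply: absv_iota_lt1 => //; exact: lbounded_bracket.
  by rewrite absvX exprn_ilt1 ?absv_ge0// -lt0n expn_gt0 finField_card_gt0.
symmetry; apply: (substitution_unique (w := usol iota ^~ _)
  (w' := fun s => usol iota (s ^+ (q ^ m)) l) (absv_addX_lt1 l1')) => //.
  exact: usol_substitution.
have := substitution_card m (usol_substitution l1).
rewrite -addrA -rmorphD /bracket subrK rmorphXn.
rewrite exprDn_pchar//.
exact: (card_pchar_nat (iota \o cst)).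
Qed.

Lemma substitution0_lXM w t : substitution iota 0 w -> lbounded t 1 ->
  w t = 0.
Proof.
by move=> [_ wX _ _] /(@lbounded_nat _ _ 1)[s s0 ->]; rewrite expr1 wX// mul0r.
Qed.

Lemma addX_eq l t : l + iota X = iota t -> l = iota (t - X).
Proof. by move=> e; rewrite rmorphB -e addrK. Qed.

Lemma usol_analytic l : absv l < 1 ->
  analytic_on iota (lint R) (fun t => usol iota t l) <->
  exists j, l = iota (bracket F j).
Proof.
move=> l1; have su := usol_substitution l1; split=> [[b [/lintE b0 [c ch]]]|].
  case: (analytic_substitution iota_abs (N := 0) (b := b) (c := c)
    (absv_addX_lt1 l1) su).
  - move=> s s0; have [uD _ _ _] := su; rewrite expr0 mul1r -uD//.
    have /ch : lint R (b + s) by apply/lintE; exact: lboundedD.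
    by rewrite addrC addKr.
  - by move=> [j e]; exists j; exact: addX_eq.
  - by move=> [].
move=> [j ->]; exists 0; split; first by apply/lintE; exact: lbounded0.
exists (fun n => (n == q ^ j)%N%:R) => t /lintE t0.
rewrite usol_bracket// subr0 rmorphXn.
rewrite [X in _ --> X](_ : _ =
    series (fun n => (n == q ^ j)%N%:R * iota t ^+ n) (q ^ j).+1).
  by apply: series_eventually0 => n jn; rewrite gtn_eqF// mul0r.
rewrite seriesEnat /= big_nat_recr //= eqxx mul1r big_nat big1 ?add0r// => n.
by move=> /andP[_ nj]; rewrite ltn_eqF// mul0r.
Qed.

Lemma usol_locally_analytic l : absv l < 1 ->
    (forall j, l <> iota (bracket F j)) ->
  locally_analytic iota (fun t => usol iota t l) <-> l = - iota X.
Proof.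
move=> l1 lj; have su := usol_substitution l1; have [uD _ _ _] := su.
have l00 : lbounded (0 : K) 0 := @lbounded0 F 0.
split=> [/(_ 0 (proj2 (lintE R 0) l00))[r r0 [b [[/lintE b0 br] [c ch]]]]
  |le a /lintE a0].
  (* Analyticity near 0 is enough. This N gives q^(-N) < r, so the multiples of x^N, translated by
     the center [b], stay in the ball. *)
  have [|N hN] := @geom_small R q%:R^-1 r 1 _ r0.
    by rewrite invr_ge0 ler0n card_inv_lt1.
  case: (analytic_substitution iota_abs (N := N) (b := b) (c := c)
    (absv_addX_lt1 l1) su).
  - move=> s s0; have Xs : lbounded (X ^+ N * s) N.
      by rewrite -[Posz N]add0r lbounded_lXnM.
    have Xs0 : lbounded (X ^+ N * s) 0 by exact: lbounded_le Xs.
    rewrite -uD//; have /ch : lball 0 r (b + X ^+ N * s).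
      split; first by apply/lintE; exact: lboundedD.
      move: br; rewrite !subr0 -!iota_abs rmorphD => br; apply: absvD_le => //.
      rewrite (le_trans (proj2 (absv_iota_le iota_abs _ _) Xs))//.
      by have := ltW (hN N (leqnn N)); rewrite mulr1 exprVn exprnN.
    by rewrite addrC addKr.
  - by move=> [j e]; case: (lj j); exact: addX_eq.
  - by move=> [/eqP]; rewrite addr_eq0 => /eqP.
(* For z = 0 the function kills multiples of x, so it is constant on each ball of radius 1/q. *)
exists q%:R^-1; first by rewrite invr_gt0 ltr0n finField_card_gt0.
have qE : q%:R^-1 = q%:R ^ (- (1 : int)) :> R by rewrite exprN1.
exists a; split.
  split; first exact/lintE.
  by rewrite subrr qE; apply/labs_le; exact: lbounded0.
exists (fun n => if n == 0%N then usol iota a l else 0) => t [/lintE t0].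
rewrite qE => /labs_le ta; have ta0 : lbounded (t - a) 0 by exact: lboundedB.
rewrite le addNr in su.
have -> : usol iota t l = usol iota a l.
  rewrite -[t in LHS](subrK a) uD// -[RHS]add0r; congr (_ + _).
  by rewrite le; apply: (substitution0_lXM (w := usol iota ^~ (- iota X))).
rewrite [X in _ --> X](_ : _ = series (fun n =>
    (if n == 0%N then usol iota a l else 0) * iota (t - a) ^+ n) 1).
  by apply: series_eventually0 => -[|n] // _; rewrite mul0r.
by rewrite seriesEnat /= big_nat1 /= expr0 mulr1.
Qed.

Lemma usol_oppX t : lbounded t 1 -> usol iota t (- iota X) = 0.
Proof.
move=> t1; apply: (substitution0_lXM (w := usol iota ^~ (- iota X))) => //.
rewrite -(addNr (iota X)); apply: usol_substitution.
by rewrite absvN; exact: absv_iotaX_lt1.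
Qed.

End Expansion.

Theorem theorem1 (R : realType) (F : finFieldType)
    (* Kbar is an algebraic closure of K = laurent F *)
    (Kbar : closedFieldType) (i : {rmorphism laurent F -> Kbar})
    (i_alg : forall z : Kbar, algebraicOver i z)
    (* C is the completion of Kbar for the extension of the absolute value *)
    (C : completeNonArchFieldType R) (k : {rmorphism Kbar -> C})
    (k_dense : dense (range k))
    (k_abs : forall t : laurent F, absv (k (i t)) = labs R t) :
  let iota := fun t : laurent F => k (i t) in
  let u := usol iota in
  (forall lambda : C, absv lambda < 1 ->
    [/\ (* u is the solution of the equation with c_0 = 1 *)
        [/\ carlitz_expansion iota (ucoef iota lambda) (u^~ lambda),
            ucoef iota lambda 0%N = 1,
            carlitz_equation iota lambda (u^~ lambda) &
            forall (c : nat -> C) (v : laurent F -> C),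
              carlitz_expansion iota c v -> c 0%N = 1 ->
              carlitz_equation iota lambda v ->
              forall t, lint R t -> v t = u t lambda],
        (* (i) *)
        continuous_on_lint (u^~ lambda),
        (* (ii) *)
        (analytic_on iota (lint R) (u^~ lambda)
           <-> exists j : nat, lambda = iota (bracket F j))
        /\ (forall j : nat, lambda = iota (bracket F j) ->
             forall t, lint R t -> u t lambda = iota (t ^+ (#|F| ^ j))) &
        (* (iii) *)
        (forall j : nat, lambda <> iota (bracket F j)) ->
        (locally_analytic iota (u^~ lambda) <-> lambda = - iota (lX F))
        /\ (lambda = - iota (lX F) ->
             forall t, lint R t -> labs R t <= #|F|%:R^-1 -> u t lambda = 0)])
  /\ (* (iv) *)
  (forall (lambda : C) (m : nat), absv lambda < 1 ->
    forall t, lint R t ->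
      u (t ^+ (#|F| ^ m)) lambda
      = u t (lambda ^+ (#|F| ^ m) + iota (bracket F m))).
Proof.
(* [I] equips the composite embedding with its ring morphism structure, as the preceding lemmas
   require. *)
pose I : {rmorphism laurent F -> C} := k \o i.
have I_abs t : absv (I t) = labs R t := k_abs t.
split=> [lambda l1|lambda m l1 t /lintE t0]; last exact: (usol_card I_abs).
split.
- split.
  + exact: (usol_expansion I_abs).
  + by rewrite /ucoef big_ord0.
  + exact: (usol_equation I_abs).
  + by move=> c v; exact: (usol_unique I_abs).
- apply: (substitution_continuous (iota := I) (z := lambda + I (lX F))).
    exact: (absv_addX_lt1 I_abs).
  exact: (usol_substitution I_abs).
- split; first exact: (usol_analytic I_abs).
  by move=> j -> t /lintE t0; exact: (usol_bracket I_abs).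
- move=> lj; split; first exact: (usol_locally_analytic I_abs).
  (* The bound 1/q on |t| says that t is divisible by x. *)
  move=> -> t _; rewrite -exprN1 => /labs_le t1; exact: (usol_oppX I_abs).
Qed.
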